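(* Let $P$ be a loop-free and passive program with reachability verification condition $VC$, and let $\mathcal{R}=\{R_0,\dots,R_n\}$ be the set of reachability variables used in $VC$. The Path Coverage Algorithm, started with the arguments $VC$ and $\mathcal{R}$, terminates and returns a set $TC$ of valuations. For every feasible complete path $\pi$ of $P$ there is a test case in $TC$ for $\pi$.
   Context: Programs. A (passive) program consists of finitely many blocks $\mathrm{Block}_0,\dots,\mathrm{Block}_n$. Each $\mathrm{Block}_i$ consists of a (possibly empty) finite sequence of statements $S_i$ followed by a non-deterministic goto to the blocks with indices in a set $Succ_i\subseteq\{0,\dots,n\}$. $\mathrm{Block}_0$ is the unique initial block and $\mathrm{Block}_n$ is the unique final block, i.e. the only block with $Succ_n=\emptyset$. Passive means that all statements have the form $\mathbf{assume}\ E$, where $E$ is a Boolean-sorted first-order expression over the program variables, interpreted in a fixed background structure; no statement changes a variable, so a state is a valuation of all program variables and stays constant during an execution. Loop-free means that the directed graph on $\{0,\dots,n\}$ with edges $i\to j$ for $j\in Succ_i$ is acyclic. Put $Pre_i=\{j : i\in Succ_j\}$. Paths. A path is a sequence of blocks in which each block is followed by one of its successors; it is complete if it starts in $\mathrm{Block}_0$ and ends in $\mathrm{Block}_n$. A path is feasible if there is a valuation of the program variables under which every assumed expression $E$ in every block of the path is true. Weakest liberal precondition. $wlp(\mathbf{assume}\ E, Q) = (E\Rightarrow Q)$ and $wlp(S;T,Q)=wlp(S,wlp(T,Q))$ (and $wlp$ of the empty sequence with respect to $Q$ is $Q$). Reachability verification condition. Introduce fresh Boolean variables $B_0,\dots,B_n$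 and $R_0,\dots,R_n$. Let $$WLP:\quad \bigwedge_{0\le i<n}\Bigl(B_i \equiv \neg wlp\bigl(S_i,\bigwedge_{j\in Succ_i}\neg B_j\bigr)\Bigr)\ \wedge\ \bigl(B_n\equiv\neg wlp(S_n,\mathrm{false})\bigr),$$ $$VC:\quad WLP\ \wedge\ (R_0\equiv B_0)\ \wedge\ \bigwedge_{1\le i\le n}\Bigl(R_i\equiv B_i\wedge\bigvee_{j\in Pre_i}R_j\Bigr).$$ $R_i$ is called the reachability variable of $\mathrm{Block}_i$. An empty disjunction is false. Test cases. A test case for $\mathrm{Block}_i$ is a valuation $\nu$ with $\nu\models VC$ and $\nu(R_i)=\mathrm{true}$. A test case for a path $\pi$ is a valuation that is a test case for every block visited by $\pi$. Oracle. $\mathrm{checksat}(\psi)$ is an oracle which, for every formula $\psi$ it is given, returns some valuation of the free variables satisfying $\psi$ if $\psi$ is satisfiable (over the fixed background structure), and returns the empty set otherwise. Nothing else is assumed about which satisfying valuation is returned. Path Coverage Algorithm (input $VC$, $\mathcal{R}$): 1. $\psi\leftarrow VC$; $TC\leftarrow\emptyset$; $\nu\leftarrow\mathrm{checksat}(\psi)$. 2. While $\nu\neq\emptyset$: set $TC\leftarrow TC\cup\{\nu\}$; let $\phi$ be the blocking clause, i.e. the disjunction over all $R\in\mathcal{R}$ of $\neg R$ if $\nu(R)=\mathrm{true}$ and of $R$ otherwise; set $\psi\leftarrow\psi\wedge\phi$; set $\nu\leftarrow\mathrm{checksat}(\psi)$. 3. Return $TC$. *)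

(* Defs.v *)
From mathcomp Require Import all_boot.
From mathcomp Require Import boolp classical_sets.

Set Implicit Arguments.
Unset Strict Implicit.
Unset Printing Implicit Defensive.

(** * Many-sorted first-order expressions with a Boolean sort *)

Inductive esort (U : Type) := SBool | SOther of U.
Arguments SBool {U}.

(* Predicate symbols are the function symbols with codomain [SBool]. *)
Record signature := Signature {
  usort : Type;
  fsym : Type;
  arity : fsym -> nat;
  fdom : forall f : fsym, 'I_(arity f) -> esort usort;
  fcod : fsym -> esort usort }.
Arguments fdom {s} f k.

Definition dom (U : Type) (carrier : U -> Type) (s : esort U) : Type :=
  match s with SBool => bool | SOther u => carrier u end.

Record structure (Sg : signature) := MkStructure {
  carrier : usort Sg -> Type;
  carrier_inh : forall u, inhabited (carrier u);
  finterp : forall f : fsym Sg,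
    (forall k, dom carrier (fdom f k)) -> dom carrier (fcod f) }.

(* The sorted family [X] with one more variable, of sort [t]: the variables in
   scope below a quantifier. *)
Inductive ext (U : Type) (X : esort U -> Type) (t : esort U) : esort U -> Type :=
| Old s of X s : ext X t s
| New : ext X t t.
Arguments Old {U X t s} x.
Arguments New {U X t}.

(* [expr X s]: expressions of sort [s] whose free variables of sort [s'] are
   drawn from [X s']. *)
Inductive expr (Sg : signature) (X : esort (usort Sg) -> Type) :
    esort (usort Sg) -> Type :=
| EVar s of X s : expr X s
| EApp f of (forall k, expr X (fdom f k)) : expr X (fcod f)
| EEq s of expr X s & expr X s : expr X SBool
| ETrue : expr X SBool
| EFalse : expr X SBool
| ENot of expr X SBool : expr X SBool
| EAnd of expr X SBool & expr X SBool : expr X SBool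
| EOr of expr X SBool & expr X SBool : expr X SBool
| EImp of expr X SBool & expr X SBool : expr X SBool
| EIff of expr X SBool & expr X SBool : expr X SBool
| EForall t of expr (ext X t) SBool : expr X SBool
| EExists t of expr (ext X t) SBool : expr X SBool.
Arguments ETrue {Sg X}.
Arguments EFalse {Sg X}.

Notation formula X := (expr X SBool).

Definition ext_map (U : Type) (X Y : esort U -> Type)
    (h : forall s, X s -> Y s) (t s : esort U) (x : ext X t s) : ext Y t s :=
  match x with Old _ y => Old (h _ y) | New => New end.

Fixpoint rename (Sg : signature) (X Y : esort (usort Sg) -> Type)
    (h : forall s, X s -> Y s) (s : esort (usort Sg)) (e : expr X s) :
    expr Y s :=
  match e with
  | EVar _ x => EVar (h _ x)
  | EApp f a => EApp (fun k => rename h (a k))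
  | EEq _ a b => EEq (rename h a) (rename h b)
  | ETrue => ETrue
  | EFalse => EFalse
  | ENot a => ENot (rename h a)
  | EAnd a b => EAnd (rename h a) (rename h b)
  | EOr a b => EOr (rename h a) (rename h b)
  | EImp a b => EImp (rename h a) (rename h b)
  | EIff a b => EIff (rename h a) (rename h b)
  | EForall t a => EForall (rename (@ext_map _ _ _ h t) a)
  | EExists t a => EExists (rename (@ext_map _ _ _ h t) a)
  end.

Definition valuation (Sg : signature) (M : structure Sg)
    (X : esort (usort Sg) -> Type) : Type :=
  forall s, X s -> dom (@carrier Sg M) s.

Definition vext (Sg : signature) (M : structure Sg)
    (X : esort (usort Sg) -> Type) (t : esort (usort Sg))
    (a : dom (@carrier Sg M) t) (nu : valuation M X) :
    valuation M (ext X t) :=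
  fun s x => match x in ext _ _ s return dom (@carrier Sg M) s with
             | Old _ y => nu _ y
             | New => a
             end.

Fixpoint eval (Sg : signature) (M : structure Sg)
    (X : esort (usort Sg) -> Type) (nu : valuation M X)
    (s : esort (usort Sg)) (e : expr X s) : dom (@carrier Sg M) s :=
  match e in expr _ s return dom (@carrier Sg M) s with
  | EVar _ x => nu _ x
  | EApp f a => finterp (fun k => eval nu (a k))
  | EEq _ a b => `[< eval nu a = eval nu b >]
  | ETrue => true
  | EFalse => false
  | ENot a => ~~ eval nu a
  | EAnd a b => eval nu a && eval nu b
  | EOr a b => eval nu a || eval nu b
  | EImp a b => eval nu a ==> eval nu b
  | EIff a b => (eval nu a : bool) == eval nu b
  | EForall t a => `[< forall d, eval (vext d nu) a >]
  | EExists t a => `[< exists d, eval (vext d nu) a >]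
  end.

Definition models (Sg : signature) (M : structure Sg)
    (X : esort (usort Sg) -> Type) (nu : valuation M X) (phi : formula X) :
    bool := eval nu phi.

(** * Programs *)

Variant stmt (Sg : signature) (X : esort (usort Sg) -> Type) :=
  Assume of formula X.

(* Passive by construction; the block indices {0, ..., n} are ['I_n.+1], the
   initial block is [ord0] and the final one [ord_max]. *)
Record program (Sg : signature) (X : esort (usort Sg) -> Type) (n : nat) :=
  Program {
    block : 'I_n.+1 -> seq (stmt X);
    succs : 'I_n.+1 -> {set 'I_n.+1};
    succs_final : forall i, (succs i == finset.set0) = (i == ord_max) }.

Section ProgramDefs.

Variables (Sg : signature) (M : structure Sg) (X : esort (usort Sg) -> Type).
Variables (n : nat) (P : program X n).

Definition edge : rel 'I_n.+1 := fun i j => j \in succs P i.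

Definition loop_free : Prop := forall c, cycle edge c -> c = [::].

Definition preds (i : 'I_n.+1) : {set 'I_n.+1} :=
  finset (fun j => i \in succs P j).

Definition is_path (p : seq 'I_n.+1) : bool := sorted edge p.

Definition complete (p : seq 'I_n.+1) : bool :=
  is_path p && (if p is i :: q then (i == ord0) && (last i q == ord_max)
                else false).

Definition feasible (p : seq 'I_n.+1) : Prop :=
  exists sigma : valuation M X,
    forall i, i \in p ->
      all (fun S => let: Assume E := S in models sigma E) (block P i).

(** * Reachability verification condition *)

Inductive vcvar : esort (usort Sg) -> Type :=
| ProgVar s of X s : vcvar s
| BVar of 'I_n.+1 : vcvar SBool
| RVar of 'I_n.+1 : vcvar SBool.

Definition B (i : 'I_n.+1) : formula vcvar := EVar (BVar i).
Definition R (i : 'I_n.+1) : formula vcvar := EVar (RVar i).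

Definition wlp_stmt (S : stmt X) (Q : formula vcvar) : formula vcvar :=
  let: Assume E := S in EImp (rename ProgVar E) Q.

Definition wlp (Ss : seq (stmt X)) (Q : formula vcvar) : formula vcvar :=
  foldr wlp_stmt Q Ss.

Definition WLP : formula vcvar :=
  EAnd
    (\big[@EAnd Sg vcvar/ETrue]_(i < n.+1 | i < n)
       EIff (B i)
            (ENot (wlp (block P i)
                       (\big[@EAnd Sg vcvar/ETrue]_(j in succs P i)
                          ENot (B j)))))
    (EIff (B ord_max) (ENot (wlp (block P ord_max) EFalse))).

Definition VC : formula vcvar :=
  EAnd (EAnd WLP (EIff (R ord0) (B ord0)))
       (\big[@EAnd Sg vcvar/ETrue]_(i < n.+1 | 1 <= i)
          EIff (R i)
               (EAnd (B i)
                     (\big[@EOr Sg vcvar/EFalse]_(j in preds i) R j))).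

Definition reach_vars : seq (vcvar SBool) :=
  [seq RVar i | i <- enum 'I_n.+1].

Definition test_case (nu : valuation M vcvar) (i : 'I_n.+1) : Prop :=
  models nu VC /\ nu SBool (RVar i) = true.

Definition path_test_case (nu : valuation M vcvar) (p : seq 'I_n.+1) : Prop :=
  forall i, i \in p -> test_case nu i.

End ProgramDefs.

(** * The path coverage algorithm *)

Section Algorithm.

Variables (Sg : signature) (M : structure Sg) (Y : esort (usort Sg) -> Type).

(* [None] is the answer for an unsatisfiable query. *)
Definition sat_oracle (checksat : formula Y -> option (valuation M Y)) : Prop :=
  forall psi : formula Y,
    match checksat psi with
    | Some nu => models nu psi : Prop
    | None => ~ exists nu : valuation M Y, models nu psi
    end.

Definition blocking_clause (Rs : seq (Y SBool)) (nu : valuation M Y) :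
    formula Y :=
  \big[@EOr Sg Y/EFalse]_(r <- Rs)
     (if nu SBool r then ENot (EVar r) else EVar r).

Variables (checksat : formula Y -> option (valuation M Y))
          (Rs : seq (Y SBool)).

(* [loop_returns psi TC nu TC']: the while loop entered in the state
   [(psi, TC, nu)] terminates and [TC'] is returned. Each step is determined by
   the current state, so a derivation exists exactly when the loop
   terminates. *)
Inductive loop_returns :
    formula Y -> set (valuation M Y) -> option (valuation M Y) ->
    set (valuation M Y) -> Prop :=
| LoopExit psi TC : loop_returns psi TC None TC
| LoopStep psi TC nu TC' :
    let psi' := EAnd psi (blocking_clause Rs nu) in
    loop_returns psi' (TC `|` [set nu])%classic (checksat psi') TC' ->
    loop_returns psi TC (Some nu) TC'.

Definition path_coverage_returns (vc : formula Y) (TC : set (valuation M Y)) :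
    Prop :=
  loop_returns vc set0 (checksat vc) TC.

End Algorithm.

(* Main.v *)
Require Import Defs.
From mathcomp Require Import all_boot.
From mathcomp Require Import boolp classical_sets.

Set Implicit Arguments.
Unset Strict Implicit.
Unset Printing Implicit Defensive.

(** Every query answered by the oracle is blocked together with all valuations
    that give the same truth values to the reachability variables. There are
    finitely many such patterns, so the algorithm terminates, and when it does,
    every pattern realized by a model of [VC] is realized by an element of
    [TC]. It remains to extend a valuation [sigma] witnessing the feasibility of
    a path to a model of [VC]: let [B i] hold when the final block is reachable
    from [i], and [R i] when moreover [i] is reachable from the initial block,
    both along blocks whose assumptions hold under [sigma]. *)

Section Evaluation.

Variables (Sg : signature) (M : structure Sg).

Lemma eval_rename (X Y : esort (usort Sg) -> Type) (h : forall s, X s -> Y s)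
    (s : esort (usort Sg)) (e : expr X s) (nu : valuation M Y) :
  eval nu (rename h e) = eval (fun s x => nu s (h s x)) e.
Proof.
have vext_map (Z W : esort (usort Sg) -> Type) (g : forall s, Z s -> W s) t
    (d : dom (@carrier Sg M) t) (mu : valuation M W) :
  (fun s x => vext d mu (ext_map g x)) = vext (t := t) d (fun s x => mu s (g s x)).
  by apply: functional_extensionality_dep => u; apply/funext => -[].
(* The target family, the renaming and the valuation are all generalized, because going below a
   quantifier changes all three. *)
elim: e Y h nu => //=.
- move=> Z f a IH Y h nu; congr finterp.
  by apply: functional_extensionality_dep => k; exact: IH.
- by move=> Z u a IHa b IHb Y h nu; rewrite IHa IHb.
- by move=> Z a IHa Y h nu; rewrite IHa.
- by move=> Z a IHa b IHb Y h nu; rewrite IHa IHb.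
- by move=> Z a IHa b IHb Y h nu; rewrite IHa IHb.
- by move=> Z a IHa b IHb Y h nu; rewrite IHa IHb.
- by move=> Z a IHa b IHb Y h nu; rewrite IHa IHb.
- move=> Z t a IH Y h nu; congr asbool.
  by apply: eq_forall => d; rewrite IH vext_map.
- move=> Z t a IH Y h nu; congr asbool.
  by apply: eq_exists => d; rewrite IH vext_map.
Qed.

Variable Y : esort (usort Sg) -> Type.

Lemma eval_big_and (nu : valuation M Y) (I : finType) (A : pred I) (F : I -> formula Y) :
  eval nu (\big[@EAnd Sg Y/ETrue]_(i | A i) F i)
  = [forall (i | A i), eval nu (F i)].
Proof.
rewrite -big_andE.
exact: (big_morph (fun e : formula Y => eval nu e : bool) (id1 := true)).
Qed.

Lemma eval_big_or (nu : valuation M Y) (I : finType) (A : pred I) (F : I -> formula Y) :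
  eval nu (\big[@EOr Sg Y/EFalse]_(i | A i) F i)
  = [exists (i | A i), eval nu (F i)].
Proof.
rewrite -big_orE.
exact: (big_morph (fun e : formula Y => eval nu e : bool) (id1 := false)).
Qed.

(** Each literal is true under [nu] exactly when [nu] and [mu] differ on its variable, so the clause
    fails only on the pattern of [mu]. *)
Lemma eval_blocking_clause (Rs : seq (Y SBool)) (mu nu : valuation M Y) :
  eval nu (blocking_clause Rs mu)
  = ([seq mu SBool r | r <- Rs] != [seq nu SBool r | r <- Rs] :> seq bool).
Proof.
rewrite /blocking_clause; elim: Rs => [|r Rs IH]; first by rewrite big_nil.
rewrite big_cons /= IH eqseq_cons negb_and; congr (_ || _).
by case: (mu SBool r); case E: (nu SBool r); rewrite /= E.
Qed.

Lemma models_and_blocking_clause (psi : formula Y) (Rs : seq (Y SBool))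
    (mu nu : valuation M Y) :
  models nu (EAnd psi (blocking_clause Rs mu))
  = models nu psi
    && ([seq mu SBool r | r <- Rs] != [seq nu SBool r | r <- Rs] :> seq bool).
Proof. by rewrite -eval_blocking_clause. Qed.

End Evaluation.

Section PathCoverage.

Variables (Sg : signature) (M : structure Sg) (Y : esort (usort Sg) -> Type).
Variables (checksat : formula Y -> option (valuation M Y)).
Variables (Rs : seq (Y SBool)).

Let pattern (nu : valuation M Y) : seq bool := [seq nu SBool r | r <- Rs].

(** Tuples of fixed length form a finite type, so the patterns of models can be counted. *)
Let realizable (psi : formula Y) : pred ((size Rs).-tuple bool) :=
  fun t => `[< exists2 nu, models nu psi & pattern nu = t >].

(** The number of realizable patterns drops at each iteration. *)
Lemma loop_terminates (psi : formula Y) (TC : set (valuation M Y)) :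
  sat_oracle checksat ->
  exists TC', loop_returns checksat Rs psi TC (checksat psi) TC'.
Proof.
move=> checksatP; have [m] := ubnP #|realizable psi|.
elim: m psi TC => // m IH psi TC lem.
case E: (checksat psi) => [nu|]; last by exists TC; exact: LoopExit.
have nu_psi : models nu psi by have := checksatP psi; rewrite E.
have [|TC' loop] := IH (EAnd psi (blocking_clause Rs nu)) (TC `|` [set nu])%classic.
  rewrite -ltnS; apply: leq_trans lem; rewrite ltnS; apply: proper_card.
  apply/properP; split.
    apply/fintype.subsetP => t /asboolP[mu /andP[mu_psi _] mut].
    by apply/asboolP; exists mu.
  (* The pattern lost is that of [nu], which no model of the blocking clause has. *)
  exists (map_tuple (nu SBool) (in_tuple Rs)); first by apply/asboolP; exists nu.
  apply/asboolP => -[mu]; rewrite models_and_blocking_clause.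
  by move=> /andP[_ /eqP ne] /= eq; apply: ne.
by exists TC'; apply: LoopStep.
Qed.

Lemma loop_returns_sub (psi : formula Y) TC o TC' :
  loop_returns checksat Rs psi TC o TC' -> (TC `<=` TC')%classic.
Proof.
elim=> {psi TC o TC'} [psi TC|psi TC nu TC' psi' _ sub] mu TCmu //.
by apply: sub; left.
Qed.

(** The loop cannot exit while [mu] is a model of the query, and [mu] stops being one only when a
    valuation with its pattern is blocked, hence collected. *)
Lemma loop_returns_cover (psi : formula Y) TC TC' (mu : valuation M Y) :
  sat_oracle checksat ->
  loop_returns checksat Rs psi TC (checksat psi) TC' -> models mu psi ->
  exists2 nu, TC' nu & models nu psi /\
    [seq nu SBool r | r <- Rs] = [seq mu SBool r | r <- Rs] :> seq bool.
Proof.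
move=> checksatP; move Eo: (checksat psi) => o loop.
elim: loop Eo => {psi TC o TC'} [psi TC|psi TC nu TC' psi' loop IH] Eo mu_psi.
  by have := checksatP psi; rewrite Eo => -[]; exists mu.
have nu_psi : models nu psi by have := checksatP psi; rewrite Eo.
have [eq|ne] := eqVneq (pattern nu) (pattern mu).
  by exists nu => //; apply: (loop_returns_sub loop); right.
have [//||nu' TCnu' []] := IH; rewrite models_and_blocking_clause.
  exact/andP.
by case/andP=> nu'_psi _ eq; exists nu'.
Qed.

End PathCoverage.

Section CanonicalModel.

Variables (Sg : signature) (M : structure Sg) (X : esort (usort Sg) -> Type).
Variables (n : nat) (P : program X n) (sigma : valuation M X).

Definition block_holds (i : 'I_n.+1) : bool :=
  all (fun S => let: Assume E := S in models sigma E) (block P i).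

Definition exec_edge : rel 'I_n.+1 :=
  fun i j => [&& edge P i j, block_holds i & block_holds j].

(** Since [connect] is reflexive, it is the first conjunct that makes the assumptions of [ord_max]
    count when [i] is [ord_max]. *)
Definition reaches_final (i : 'I_n.+1) : bool :=
  block_holds i && connect exec_edge i ord_max.

Definition reachable (i : 'I_n.+1) : bool :=
  reaches_final i && connect exec_edge ord0 i.

Definition canonical_model : valuation M (vcvar X n) :=
  fun s x => match x in vcvar _ _ s return dom (@carrier Sg M) s with
             | ProgVar _ y => sigma y
             | BVar i => reaches_final i
             | RVar i => reachable i
             end.

(** The model agrees with [sigma] on program variables, and the nested implications merge into
    one. *)
Lemma eval_wlp (i : 'I_n.+1) (Q : formula (vcvar X n)) :
  eval canonical_model (wlp (block P i) Q)
  = (block_holds i ==> eval canonical_model Q).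
Proof.
rewrite /block_holds; elim: (block P i) => [|[E] Ss IH] //=.
by rewrite IH eval_rename /models; case: (eval sigma E).
Qed.

(** The equation of [WLP] for [B i], read off the first edge of a path to the final block. *)
Lemma reaches_final_step (i : 'I_n.+1) : i != ord_max ->
  reaches_final i = block_holds i && [exists (j | j \in succs P i), reaches_final j].
Proof.
move=> i_max; rewrite /reaches_final.
have [hi|//] := boolP (block_holds i); apply/connectP/exists_inP.
  move=> [[|j p] /= ep el]; first by rewrite el eqxx in i_max.
  case/andP: ep => /and3P[eij _ hj] ep; exists j => //.
  by rewrite hj /=; apply/connectP; exists p.
move=> [j eij /andP[hj /connectP[p ep el]]]; exists (j :: p) => //=.
by rewrite ep andbT; apply/and3P.
Qed.

(** The equation of [VC] for [R i], read off the last edge of a path from the initial block. *)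
Lemma reachable_step (i : 'I_n.+1) : i != ord0 ->
  reachable i = reaches_final i && [exists (j | j \in preds P i), reachable j].
Proof.
move=> i0; rewrite /reachable.
have [hi|//] := boolP (reaches_final i); apply/connectP/exists_inP => /=.
  move=> [p]; case/lastP: p => [|p k] /=; first by move=> _ ei; rewrite ei eqxx in i0.
  rewrite rcons_path last_rcons => /andP[ep el] ik.
  rewrite -{k}ik in el; have /and3P[eli hl _] := el.
  exists (last ord0 p); first by rewrite inE.
  apply/andP; split; last by apply/connectP; exists p.
  (* The predecessor reaches the final block through [i]. *)
  rewrite /reaches_final hl; apply: connect_trans (connect1 el) _.
  by case/andP: hi.
move=> [j]; rewrite inE => eji /andP[/andP[hj _] /connectP[p ep el]].
exists (rcons p i); last by rewrite last_rcons.
rewrite rcons_path ep -el /=; apply/and3P; split=> //.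
by case/andP: hi.
Qed.

Lemma canonical_model_VC : models canonical_model (VC P).
Proof.
rewrite /models /VC /WLP /= !eval_big_and !eval_wlp /=.
apply/andP; split; [apply/andP; split; [apply/andP; split|]|].
- apply/forall_inP => i lin /=; rewrite eval_wlp eval_big_and /=.
  have i_max : i != ord_max by rewrite -val_eqE neq_ltn lin.
  rewrite reaches_final_step // negb_imply negb_forall_in.
  by under [X in _ == _ && X]eq_existsb => j do rewrite negbK.
- by rewrite /reaches_final connect0 andbT implybF negbK.
- by rewrite /reachable connect0 andbT.
- apply/forall_inP => i i_gt0 /=; rewrite eval_big_or /=.
  by rewrite reachable_step // -val_eqE -lt0n.
Qed.

(** Cutting the path at [i] leaves a prefix from the initial block and a suffix to the final one,
    both made of [exec_edge] steps. *)
Lemma path_reachable (p : seq 'I_n.+1) :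
  complete P p -> {in p, forall i, block_holds i} -> {in p, forall i, reachable i}.
Proof.
rewrite /complete /is_path; case: p => [|k p] /=; first by [].
case/andP=> ep /andP[/eqP k0 /eqP el]; rewrite {k}k0 in ep el * => hp i ip.
have {}ep : path exec_edge ord0 p.
  have hall : all block_holds (ord0 :: p) by apply/allP.
  apply: (sub_in_path _ hall ep) => x y hx hy exy; exact/and3P.
have hi := hp i ip.
case/splitPl: ip ep el => p1 p2 el1; rewrite cat_path el1 => /andP[ep1 ep2] el2.
rewrite /reachable /reaches_final hi /=; apply/andP; split; apply/connectP.
  by exists p2; rewrite // -el2 last_cat el1.
by exists p1.
Qed.

End CanonicalModel.

Theorem theorem4 (Sg : signature) (M : structure Sg)
    (X : esort (usort Sg) -> Type) (n : nat) (P : program X n)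
    (checksat : formula (vcvar X n) -> option (valuation M (vcvar X n))) :
  loop_free P ->
  sat_oracle checksat ->
  (exists TC : set (valuation M (vcvar X n)),
      path_coverage_returns checksat (reach_vars X n) (VC P) TC) /\
  (forall TC : set (valuation M (vcvar X n)),
      path_coverage_returns checksat (reach_vars X n) (VC P) TC ->
      forall p : seq 'I_n.+1,
        complete P p -> feasible M P p ->
        exists2 nu : valuation M (vcvar X n),
          TC nu & path_test_case P nu p).
Proof.
move=> _ checksatP; split; first exact: loop_terminates.
move=> TC loop p cp [sigma sigma_p].
have [nu TCnu [nu_VC]] :=
  loop_returns_cover checksatP loop (canonical_model_VC P sigma).
(* The program variables may differ between [nu] and [sigma]; equal patterns still give every [R i]
   its value in the canonical model. *)
rewrite /reach_vars -[LHS]map_comp -[RHS]map_comp => /eq_in_map eq_nu.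
exists nu => // i ip; split=> //.
rewrite [LHS]eq_nu ?mem_enum //=.
exact: path_reachable cp sigma_p i ip.
Qed.
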